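(* Let $M$ be a mixed graph of order $n$ with underlying graph $M_U$, let $\mu_1\ge\cdots\ge\mu_n$ be the eigenvalues of $R_H(M)$, and let $p=|\det R_H(M)|$. Then $$\sqrt{2R_{-1}(M_U)+n(n-1)p^{2/n}}\le\mathcal{E}_{R_H}(M)\le\sqrt{2nR_{-1}(M_U)},$$ and equality holds in the lower bound, and in the upper bound, if and only if there is a constant $c$ with $c=|\mu_i|^2$ for all $i$ such that $R_H(M)^2=c\,I_n$.
   Context: A mixed graph $M$ is obtained from a simple graph $M_U$ by orienting some of its edges; degrees $d_k$ are taken in $M_U$. The Hermitian-Randić matrix $R_H(M)$ has $(k,l)$ entry $\frac{1}{\sqrt{d_kd_l}}$ if $v_kv_l$ is an undirected edge, $\frac{\mathrm{i}}{\sqrt{d_kd_l}}$ if $(v_k,v_l)$ is an arc, $\frac{-\mathrm{i}}{\sqrt{d_kd_l}}$ if $(v_l,v_k)$ is an arc, and $0$ otherwise. $\mathcal{E}_{R_H}(M)=\sum_{i=1}^n|\mu_i|$. For a graph $G$, $R_{-1}(G)=\sum_{v_jv_k\in E(G)}\frac{1}{d_jd_k}$, summed over unordered edges. *)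

(* Defs.v *)
From HB Require Import structures.
From mathcomp Require Import all_boot all_order all_algebra.
From mathcomp Require Import complex reals exp.

Set Implicit Arguments.
Unset Strict Implicit.
Unset Printing Implicit Defensive.

Import Order.TTheory GRing.Theory Num.Theory.

Local Open Scope ring_scope.
Local Open Scope complex_scope.

Record sgraph (n : nat) := SGraph {
  adj : rel 'I_n;
  adj_sym : symmetric adj;
  adj_irr : irreflexive adj
}.

Definition degree (n : nat) (G : sgraph n) (k : 'I_n) : nat :=
  #|[set l | adj G k l]|.

(* Each unordered edge is counted once, through its representation with j < k. *)
Definition randic_m1 (R : realType) (n : nat) (G : sgraph n) : R :=
  \sum_(j < n) \sum_(k < n | (j < k)%N && adj G j k)
     1 / ((degree G j)%:R * (degree G k)%:R).

(* [is_arc M k l] means that the edge kl has been oriented from k to l; the edges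
   of the underlying graph with no arc in either direction stay undirected. *)
Record mixed_graph (n : nat) := MixedGraph {
  underlying : sgraph n;
  is_arc : rel 'I_n;
  arc_adj : forall k l, is_arc k l -> adj underlying k l;
  arc_asym : forall k l, is_arc k l -> ~~ is_arc l k
}.

Definition undirected_edge (n : nat) (M : mixed_graph n) (k l : 'I_n) : bool :=
  [&& adj (underlying M) k l, ~~ is_arc M k l & ~~ is_arc M l k].

Definition hermitian_randic (R : realType) (n : nat) (M : mixed_graph n) :
    'M[R[i]]_n :=
  \matrix_(k, l)
    let w : R := Num.sqrt ((degree (underlying M) k)%:R
                           * (degree (underlying M) l)%:R) in
    if undirected_edge M k l then 1 / w%:C
    else if is_arc M k l then (0 +i* 1) / w%:C
    else if is_arc M l k then - (0 +i* 1) / w%:C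
    else 0.

(* [mu] lists the eigenvalues of [A], with algebraic multiplicity, in
   nonincreasing order.  They are taken in [R], which loses nothing for a
   Hermitian matrix. *)
Definition ordered_eigenvalues (R : realType) (n : nat) (A : 'M[R[i]]_n)
    (mu : 'I_n -> R) : Prop :=
  char_poly A = \prod_(i < n) ('X - ((mu i)%:C)%:P) /\
  (forall i j : 'I_n, (i <= j)%N -> mu j <= mu i).

Definition energy (R : realType) (n : nat) (mu : 'I_n -> R) : R :=
  \sum_(i < n) `|mu i|.

(* Main.v *)
Require Import Defs.
From HB Require Import structures.
From mathcomp Require Import all_boot all_order all_algebra.
From mathcomp Require Import sesquilinear spectral ring.
From mathcomp Require Import complex reals exp.

Set Implicit Arguments.
Unset Strict Implicit.
Unset Printing Implicit Defensive.

Import Order.TTheory GRing.Theory Num.Theory.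

Local Open Scope ring_scope.
Local Open Scope complex_scope.

(* Put a_i = |mu_i|.  The matrix is Hermitian, hence unitarily diagonalizable, so
   that sum mu_i = tr R_H = 0, sum a_i^2 = tr R_H^2 = 2 R_{-1} and prod a_i = p.
   The upper bound is Cauchy-Schwarz.  For the lower bound, expand (sum a_i)^2 and
   apply AM-GM to the n(n-1) products a_i a_j with i <> j.  Equality there makes
   these products equal, and together with sum mu_i = 0 this forces all a_i to be
   equal, also when n = 2 or p = 0.  Finally, by diagonalization, R_H^2 is scalar
   once all mu_i^2 agree. *)

(** * Trace, determinant and square of a normal matrix from its eigenvalues *)

Lemma char_poly_conj (F : fieldType) (n : nat) (P A : 'M[F]_n) :
  P \in unitmx -> char_poly (invmx P *m A *m P) = char_poly A.
Proof.
move=> Pu; rewrite /char_poly /char_poly_mx.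
set Q := map_mx (@polyC F) P; set Q' := map_mx (@polyC F) (invmx P).
have Q'Q : Q' *m Q = 1%:M by rewrite -map_mxM mulVmx // map_mx1.
have -> : 'X%:M - map_mx polyC (invmx P *m A *m P)
    = Q' *m ('X%:M - map_mx polyC A) *m Q.
  by rewrite mulmxBr mulmxBl !map_mxM (scalar_mxC 'X) -(mulmxA _ Q' Q) Q'Q mulmx1.
by rewrite !det_mulmx mulrAC -det_mulmx Q'Q det1 mul1r.
Qed.

(** The spectral theorem provides some diagonal [d]. Both [d] and [m] list the roots of the same
    characteristic polynomial, so they agree up to a permutation, which is all that sums and
    products over the spectrum require. *)
Lemma normalmx_diag (C : numClosedFieldType) (n : nat) (A : 'M[C]_n)
    (m : 'I_n -> C) :
    A \is normalmx -> char_poly A = \prod_(i < n) ('X - (m i)%:P) ->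
  exists P : 'M[C]_n, exists d : 'rV[C]_n,
    [/\ P \in unitmx, A = invmx P *m diag_mx d *m P
      & perm_eq [seq d 0 i | i <- index_enum 'I_n]
          [seq m i | i <- index_enum 'I_n]].
Proof.
move=> /orthomx_spectralP AE charA.
exists (spectralmx A), (spectral_diag A); split=> //; first exact: spectral_unit.
apply: prod_XsubC_eq; rewrite !big_map /= -charA [in RHS]AE.
rewrite char_poly_conj ?spectral_unit // char_poly_trig.
  by apply: eq_bigr => i _; rewrite mxE eqxx mulr1n.
exact/diag_mx_is_trig.
Qed.

Lemma sqr_conj_diag_mx (C : fieldType) (n : nat) (P : 'M[C]_n)
    (d : 'rV[C]_n) : P \in unitmx ->
  (invmx P *m diag_mx d *m P) *m (invmx P *m diag_mx d *m P)
    = invmx P *m diag_mx (\row_i (d 0 i) ^+ 2) *m P.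
Proof.
move=> Pu; rewrite !mulmxA mulmxK // -!mulmxA; congr (_ *m _).
by rewrite mulmxA mulmx_diag; congr (diag_mx _ *m _).
Qed.

Section NormalSpectrum.
Variables (C : numClosedFieldType) (n : nat) (A : 'M[C]_n) (m : 'I_n -> C).
Hypotheses (nA : A \is normalmx)
           (charA : char_poly A = \prod_(i < n) ('X - (m i)%:P)).

Lemma normalmx_tr : \tr A = \sum_i m i.
Proof.
have [P [d [Pu AE dm]]] := normalmx_diag nA charA.
rewrite AE mxtrace_mulC mulmxA mulmxV // mul1mx mxtrace_diag.
by rewrite -(big_map (d 0) xpredT id) -(big_map m xpredT id); apply: perm_big.
Qed.

Lemma normalmx_tr_sqr : \tr (A *m A) = \sum_i (m i) ^+ 2.
Proof.
have [P [d [Pu AE dm]]] := normalmx_diag nA charA.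
rewrite AE sqr_conj_diag_mx // mxtrace_mulC mulmxA mulmxV // mul1mx mxtrace_diag.
under eq_bigr do rewrite mxE.
rewrite -(big_map (d 0) xpredT (fun x => x ^+ 2)).
rewrite -(big_map m xpredT (fun x => x ^+ 2)); exact: perm_big.
Qed.

Lemma normalmx_det : \det A = \prod_i m i.
Proof.
have [P [d [Pu AE dm]]] := normalmx_diag nA charA.
rewrite AE !det_mulmx mulrAC -det_mulmx mulVmx // det1 mul1r det_diag.
by rewrite -(big_map (d 0) xpredT id) -(big_map m xpredT id); apply: perm_big.
Qed.

(** After diagonalization the middle factor of the square is itself scalar, so it commutes past [P]
    and the conjugation cancels. *)
Lemma normalmx_sqr_scalar (c : C) :
  (forall i, m i ^+ 2 = c) -> A *m A = c%:M.
Proof.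
move=> mc; have [P [d [Pu AE dm]]] := normalmx_diag nA charA.
rewrite AE sqr_conj_diag_mx //.
have -> : \row_i (d 0 i) ^+ 2 = const_mx c.
  apply/rowP => i; rewrite !mxE.
  have : d 0 i \in [seq m j | j <- index_enum 'I_n].
    by rewrite -(perm_mem dm) map_f // mem_index_enum.
  by case/mapP => j _ ->.
by rewrite diag_const_mx scalar_mxC mulmxKV.
Qed.

End NormalSpectrum.

(** * Cauchy-Schwarz and AM-GM with their equality cases *)

(** Lagrange's identity: twice the gap is the sum of [(a i - a j) ^+ 2] over all ordered pairs,
    which also reveals when the gap vanishes. *)
Lemma sqr_sum_leif (R : realFieldType) (n : nat) (a : 'I_n -> R) :
  (\sum_i a i) ^+ 2 <= n%:R * \sum_i a i ^+ 2
    ?= iff [forall i, forall j, a i == a j].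
Proof.
have E : (n%:R * \sum_i a i ^+ 2 - (\sum_i a i) ^+ 2) *+ 2
         = \sum_i \sum_j (a i - a j) ^+ 2.
  have -> : \sum_i \sum_j (a i - a j) ^+ 2 =
     \sum_i (n%:R * a i ^+ 2 - a i * (\sum_j a j) *+ 2 + \sum_j a j ^+ 2).
    apply: eq_bigr => i _; under eq_bigr do rewrite sqrrB.
    rewrite big_split sumrB /= sumr_const card_ord mulr_natl.
    by rewrite sumrMnl -mulr_sumr.
  rewrite big_split sumrB /= -mulr_sumr sumrMnl -mulr_suml.
  by rewrite sumr_const card_ord -[_ *+ n]mulr_natl; ring.
have ge0 i : 0 <= \sum_j (a i - a j) ^+ 2 by apply: sumr_ge0 => j _; apply: sqr_ge0.
split.
  by rewrite -subr_ge0 -(pmulrn_lge0 _ (n := 2)) // E; apply: sumr_ge0.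
(* The false disjunct lets [mulrn_eq0], read backwards, replace the gap by its double, to which [E]
   applies. *)
rewrite eq_sym -subr_eq0 -[_ == 0]/((2 == 0)%N || _) -mulrn_eq0 E psumr_eq0 //.
apply/allP/forallP => [H i|H i _].
  apply/forallP => j; have := H i; rewrite mem_index_enum => /(_ isT) /=.
  rewrite psumr_eq0 => [/allP/(_ j)|k _]; last exact: sqr_ge0.
  by rewrite mem_index_enum => /(_ isT) /=; rewrite sqrf_eq0 subr_eq0.
rewrite /= big1 // => j _.
by have /forallP/(_ j)/eqP-> := H i; rewrite subrr expr0n.
Qed.

Lemma card_offdiag (n : nat) :
  #|[pred x : 'I_n * 'I_n | x.1 != x.2]| = (n * n.-1)%N.
Proof.
rewrite -sum1_card (eq_bigl (fun x : 'I_n * 'I_n => true && (x.1 != x.2))) //.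
rewrite -(pair_big_dep xpredT (fun i j : 'I_n => i != j) (fun _ _ => 1%N)) /=.
under eq_bigr => i _.
  rewrite sum1_card (eq_card (B := predC1 i)) => [|j]; last by rewrite !inE eq_sym.
  rewrite cardC1 card_ord.
  over.
by rewrite sum_nat_const card_ord.
Qed.

(** Each index is the first coordinate of [n.-1] off-diagonal pairs and, by swapping coordinates,
    the second coordinate of as many. *)
Lemma prod_offdiag (R : comPzRingType) (n : nat) (a : 'I_n -> R) :
  \prod_(x : 'I_n * 'I_n | x.1 != x.2) (a x.1 * a x.2)
    = (\prod_i a i) ^+ (2 * n.-1).
Proof.
have fst_prod : \prod_(x : 'I_n * 'I_n | x.1 != x.2) a x.1
    = (\prod_i a i) ^+ n.-1.
  rewrite (eq_bigl (fun x : 'I_n * 'I_n => true && (x.1 != x.2))) //.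
  rewrite -(pair_big_dep xpredT (fun i j : 'I_n => i != j) (fun i _ => a i)) /=.
  rewrite -prodrXl; apply: eq_bigr => i _; rewrite prodr_const.
  rewrite (eq_card (B := predC1 i)) ?cardC1 ?card_ord // => j.
  by rewrite !inE eq_sym.
rewrite big_split /= fst_prod mul2n -addnn exprD; congr (_ * _).
rewrite -fst_prod [LHS](reindex_inj (h := fun x : 'I_n * 'I_n => (x.2, x.1))) /=.
  by apply: eq_bigl => x; rewrite eq_sym.
by move=> [i j] [k l] [-> ->].
Qed.

(** The n(n-1) products multiply to the power 2(n-1) of the product of all [a i], so their geometric
    mean is its power 2/n. *)
Lemma offdiag_AGM (R : realType) (n : nat) (a : 'I_n -> R) :
    (forall i, 0 <= a i) ->
  let A := [pred x : 'I_n * 'I_n | x.1 != x.2] in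
  n%:R * (n%:R - 1) * (\prod_i a i) `^ (2 / n%:R)
    <= \sum_(x in A) (a x.1 * a x.2)
    ?= iff [forall x in A, forall y in A, a x.1 * a x.2 == a y.1 * a y.2].
Proof.
move=> a0 A.
have -> : n%:R * (n%:R - 1) = #|A|%:R :> R.
  (* For [n = 0] the truncated [n.-1] differs from [n%:R - 1], but the factor [n] kills both
     sides. *)
  by rewrite card_offdiag; case: n {a a0 A} => [|n]; rewrite ?mul0r // natrM -natr1 addrK.
(* With no off-diagonal pair both sides are 0 and the equality condition is vacuous. *)
have [A0|A_gt0] := posnP #|A|.
  rewrite A0 mul0r big_pred0 => [|x]; last by rewrite (card0_eq A0).
  split; rewrite // eqxx; apply/esym/forall_inP => x.
  by rewrite (card0_eq A0).
have p0 : 0 <= \prod_i a i by apply: prodr_ge0.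
have S0 : 0 <= \sum_(x in A) (a x.1 * a x.2).
  by apply: sumr_ge0 => x _; apply: mulr_ge0.
have T0 : 0 <= #|A|%:R * (\prod_i a i) `^ (2 / n%:R) by rewrite mulr_ge0 ?powR_ge0.
(* The scaled AM-GM bounds this product by the power [#|A|] of the sum. Once the product is written
   as such a power too, the exponent can be removed by monotonicity on nonnegative numbers. *)
have prodE : \prod_(x in A) (a x.1 * a x.2 *+ #|A|)
    = (#|A|%:R * (\prod_i a i) `^ (2 / n%:R)) ^+ #|A|.
  under eq_bigr do rewrite -mulr_natl.
  rewrite big_split /= prodr_const exprMn; congr (_ * _).
  rewrite (eq_bigl (fun x : 'I_n * 'I_n => x.1 != x.2)) // prod_offdiag.
  rewrite -[RHS]powR_mulrn ?powR_ge0 // -powRrM -powR_mulrn //; congr (_ `^ _).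
  move: A_gt0; rewrite card_offdiag muln_gt0 => /andP[n0 _].
  by rewrite !natrM mulrA divfK // pnatr_eq0 -lt0n.
have [|] := @leif_AGM_scaled _ _ A (fun x => a x.1 * a x.2).
  by move=> x _; rewrite mulrn_wge0 ?mulr_ge0.
rewrite prodE => le eq; by split; [rewrite -(ler_pXn2r A_gt0) | rewrite -eq eqrXn2].
Qed.

(** * The Hermitian-Randić matrix: symmetry and traces *)

Lemma undirected_edge_sym (n : nat) (M : mixed_graph n) (k l : 'I_n) :
  undirected_edge M k l = undirected_edge M l k.
Proof. by rewrite /undirected_edge adj_sym [X in _ && X]andbC. Qed.

Lemma hermitian_randic_hermsym (R : realType) (n : nat) (M : mixed_graph n) :
  hermitian_randic R M \is hermsymmx.
Proof.
rewrite is_hermitianmxE expr0 scale1r; apply/eqP/matrixP => k l.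
rewrite !mxE /= undirected_edge_sym [(degree _ l)%:R * _]mulrC.
set w := Num.sqrt _.
have wJ : Num.conj (w%:C) = w%:C :> R[i] by apply/conj_Creal/complex_realP; exists w.
have iJ : Num.conj (0 +i* 1) = - (0 +i* 1) :> R[i].
  by apply/eqP; rewrite eq_complex /= oppr0 !eqxx.
case: ifP => _; first by rewrite fmorph_div /= rmorph1 wJ.
case: ifP => [kl|_]; case: ifP => [lk|_].
- by have := arc_asym kl; rewrite lk.
- by rewrite fmorph_div /= wJ rmorphN /= iJ opprK.
- by rewrite fmorph_div /= wJ iJ.
- by rewrite rmorph0.
Qed.

Lemma degree_gt0 (n : nat) (G : sgraph n) (k l : 'I_n) :
  adj G k l -> (0 < degree G k)%N.
Proof. by move=> kl; apply/card_gt0P; exists l; rewrite inE. Qed.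

(** The two entries are conjugate, so the orientation disappears: an undirected edge contributes 1 *
    1 and an arc i * (-i) = 1 to the numerator. *)
Lemma hermitian_randic_mulC (R : realType) (n : nat) (M : mixed_graph n)
    (k l : 'I_n) :
  hermitian_randic R M k l * hermitian_randic R M l k =
  if adj (underlying M) k l
  then (1 / ((degree (underlying M) k)%:R * (degree (underlying M) l)%:R))%:C
  else 0.
Proof.
rewrite !mxE undirected_edge_sym [(degree _ l)%:R * _]mulrC.
set w := Num.sqrt _.
have w2 : w ^+ 2 = (degree (underlying M) k)%:R * (degree (underlying M) l)%:R.
  by rewrite sqr_sqrtr // mulr_ge0.
have wC : (w%:C)^-1 * (w%:C)^-1 = (1 / w ^+ 2)%:C :> R[i].
  by rewrite div1r -exprVn rmorphXn /= fmorphV expr2.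
have i2 : (0 +i* 1) * (0 +i* 1) = -1 :> R[i] by apply/eqP; rewrite -expr2 sqr_i.
rewrite -w2 -wC /undirected_edge adj_sym.
case: (boolP (is_arc M k l)) => [kl|nkl]; case: (boolP (is_arc M l k)) => [lk|nlk].
- by have := arc_asym kl; rewrite lk.
- by rewrite (arc_adj kl) /= mulrACA mulrN i2 opprK mul1r.
- by rewrite adj_sym (arc_adj lk) /= mulrACA mulNr i2 opprK mul1r.
- by rewrite !andbT; case: ifP => _; rewrite ?mulr0 // !div1r.
Qed.

Lemma hermitian_randic_tr (R : realType) (n : nat) (M : mixed_graph n) :
  \tr (hermitian_randic R M) = 0.
Proof.
apply: big1 => k _; rewrite mxE /undirected_edge adj_irr /=.
by have -> // : is_arc M k k = false by apply/negP => /arc_adj; rewrite adj_irr.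
Qed.

(** The trace runs over ordered pairs of adjacent vertices, so each edge is met twice, whereas
    [randic_m1] meets it once. *)
Lemma hermitian_randic_tr_sqr (R : realType) (n : nat) (M : mixed_graph n) :
  \tr (hermitian_randic R M *m hermitian_randic R M)
    = (2 * randic_m1 R (underlying M))%:C.
Proof.
set G := underlying M.
pose F (k l : 'I_n) : R := 1 / ((degree G k)%:R * (degree G l)%:R).
have -> : \tr (hermitian_randic R M *m hermitian_randic R M)
          = (\sum_k \sum_(l < n | adj G k l) F k l)%:C.
  rewrite rmorph_sum; apply: eq_bigr => k _; rewrite mxE rmorph_sum big_mkcond /=.
  by rewrite [RHS]big_mkcond; apply: eq_bigr => l _; apply: hermitian_randic_mulC.
congr (_%:C); rewrite /randic_m1 mulr_natl mulr2n.
have split_sum (k : 'I_n) : \sum_(l < n | adj G k l) F k l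
    = \sum_(l < n | (k < l)%N && adj G k l) F k l
      + \sum_(l < n | (l < k)%N && adj G k l) F k l.
  rewrite (bigID (fun l : 'I_n => (k < l)%N)) /=.
  congr (_ + _); apply: eq_bigl => l; first by rewrite andbC.
  rewrite -leqNgt leq_eqVlt andbC; have [/val_inj-> |//] := eqVneq (l : nat) k.
  by rewrite ltnn adj_irr.
under eq_bigr do rewrite split_sum.
rewrite big_split /=; congr (_ + _).
(* The half with [l < k] becomes the half with [k < l] once the two indices are exchanged, since
   adjacency and weight are symmetric. *)
rewrite (exchange_big_dep xpredT) //=; apply: eq_bigr => k _.
apply: eq_big => [l|l _]; first by rewrite /= adj_sym.
by rewrite /F [(degree G l)%:R * _]mulrC.
Qed.

(** * The energy bounds and their equality cases *)

Lemma sqr_sum_offdiag (R : comPzRingType) (n : nat) (a : 'I_n -> R) :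
  (\sum_i a i) ^+ 2
    = \sum_i a i ^+ 2 + \sum_(x : 'I_n * 'I_n | x.1 != x.2) (a x.1 * a x.2).
Proof.
rewrite -(pair_big_dep xpredT (fun i j : 'I_n => i != j)
  (fun i j => a i * a j)) /= -big_split /= expr2 mulr_suml.
apply: eq_bigr => i _; rewrite mulr_sumr (bigD1 i) //= expr2; congr (_ + _).
by apply: eq_bigl => j; rewrite eq_sym.
Qed.

(* If |x_i| <> |x_j|, equality of the products |x_i||x_k| and |x_j||x_k|
   kills every other x_k, and then x_i + x_j = 0. *)
Lemma offdiag_const_norm (R : realDomainType) (n : nat) (x : 'I_n -> R) :
    \sum_i x i = 0 ->
    (forall i j k, i != k -> j != k -> `|x i| * `|x k| = `|x j| * `|x k|) ->
  forall i j, `|x i| = `|x j|.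
Proof.
move=> sum0 prods i j; have [-> //|ij] := eqVneq i j.
apply/eqP; apply: contraT => neq.
have x0 k : i != k -> j != k -> x k = 0.
  move=> ik jk; have /eqP := prods i j k ik jk.
  by rewrite -subr_eq0 -mulrBl mulf_eq0 subr_eq0 (negPf neq) normr_eq0 => /eqP.
move: sum0; rewrite (bigD1 i) //= (bigD1 j) 1?eq_sym //=.
rewrite big1 => [|k /andP[ki kj]]; last by rewrite x0 // eq_sym.
by move/eqP; rewrite addr0 addr_eq0 => /eqP xi; rewrite xi normrN eqxx in neq.
Qed.

Lemma normc_real (R : rcfType) (x : R) : ComplexField.Normc.normc (x%:C) = `|x|.
Proof. by rewrite /= expr0n /= addr0 sqrtr_sqr. Qed.

Lemma normc_prod_real (R : rcfType) (I : finType) (x : I -> R) :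
  ComplexField.Normc.normc (\prod_i (x i)%:C) = \prod_i `|x i|.
Proof. by rewrite -rmorph_prod normc_real normr_prod. Qed.

Theorem theorem3p5 (R : realType) (n : nat) (hn : (0 < n)%N)
    (M : mixed_graph n) (mu : 'I_n -> R)
    (hmu : ordered_eigenvalues (hermitian_randic R M) mu) :
  let RH := hermitian_randic R M in
  let p : R := ComplexField.Normc.normc (\det RH) in
  let lower := Num.sqrt (2 * randic_m1 R (underlying M)
                         + n%:R * (n%:R - 1) * p `^ (2 / n%:R)) in
  let upper := Num.sqrt (2 * n%:R * randic_m1 R (underlying M)) in
  let extremal := exists c : R,
    (forall i, c = `|mu i| ^+ 2) /\ RH *m RH = (c%:C)%:M in
  [/\ lower <= energy mu <= upper,
      energy mu = lower <-> extremal
    & energy mu = upper <-> extremal].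
Proof.
move=> RH p lower upper extremal; have [charRH _] := hmu.
have nRH : RH \is normalmx.
  exact/hermitian_normalmx/hermitian_randic_hermsym.
have sum0 : \sum_i mu i = 0.
  by apply: complexI; rewrite rmorph_sum -(normalmx_tr nRH charRH) hermitian_randic_tr.
have sum2 : \sum_i `|mu i| ^+ 2 = 2 * randic_m1 R (underlying M).
  apply: complexI; rewrite -hermitian_randic_tr_sqr (normalmx_tr_sqr nRH charRH).
  by rewrite rmorph_sum; apply: eq_bigr => i _; rewrite real_normK ?num_real ?rmorphXn.
have pE : p = \prod_i `|mu i|.
  by rewrite /p (normalmx_det nRH charRH) normc_prod_real.
(* The matrix condition is traded for equality of all [|mu i|], the form in which both equality
   cases arise. *)
have extremalP : extremal <-> forall i j, `|mu i| = `|mu j|.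
  split=> [[c [cE _]] i j|eq_mu].
    by apply: (pexpIrn (n := 2)); rewrite ?nnegrE // -!cE.
  pose i0 := Ordinal hn; exists (`|mu i0| ^+ 2); split=> [i|].
    by rewrite (eq_mu i i0).
  apply: (normalmx_sqr_scalar nRH charRH) => i.
  by rewrite -(eq_mu i) real_normK ?num_real // rmorphXn.
have E0 : 0 <= energy mu by apply: sumr_ge0.
(* With the energy written as a square root, each bound becomes a comparison of radicands. *)
have EE : energy mu = Num.sqrt (energy mu ^+ 2) by rewrite sqrtr_sqr ger0_norm.
have := offdiag_AGM (fun i => normr_ge0 (mu i)).
rewrite /= -pE; set T := _ * p `^ _; set S := \sum_(x in _) _ => -[TS TS_eq].
have T0 : 0 <= T.
  by rewrite mulr_ge0 ?powR_ge0 // mulr_ge0 // subr_ge0 ler1n.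
have E2 : energy mu ^+ 2 = 2 * randic_m1 R (underlying M) + S.
  by rewrite /energy sqr_sum_offdiag sum2.
have R0 : 0 <= 2 * randic_m1 R (underlying M).
  by rewrite -sum2; apply: sumr_ge0 => i _; apply: sqr_ge0.
have := sqr_sum_leif (fun i => `|mu i|); rewrite sum2 -/(energy mu).
rewrite mulrCA mulrA => -[EU EU_eq].
split.
- apply/andP; split; rewrite EE; apply: ler_wsqrtr => //.
  by rewrite E2 lerD2l.
- rewrite extremalP EE; split=> [/eqP|eq_mu].
    (* The summand [2 * randic_m1] cancels, leaving [T = S], the equality case of AM-GM. *)
    rewrite eqr_sqrt ?sqr_ge0 ?addr_ge0 // E2 (inj_eq (addrI _)) eq_sym TS_eq.
    (* The pairs [(i, k)] and [(j, k)] share their second index; the vanishing trace [sum0] supplies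
       the other premise. *)
    move=> /forall_inP pairs; apply: offdiag_const_norm => // i j k ik jk.
    by have /forall_inP/(_ (j, k) jk)/eqP := pairs (i, k) ik.
  rewrite E2; congr (Num.sqrt (_ + _)); apply/esym/eqP; rewrite TS_eq.
  apply/forall_inP => x _; apply/forall_inP => y _.
  by rewrite (eq_mu x.1 y.1) (eq_mu x.2 y.2).
- rewrite extremalP EE; split=> [/eqP|eq_mu].
    rewrite eqr_sqrt ?sqr_ge0 ?(le_trans (sqr_ge0 _) EU) // EU_eq.
    by move=> /forallP eq_mu i j; have /forallP/(_ j)/eqP := eq_mu i.
  rewrite /upper; congr (Num.sqrt _); apply/eqP; rewrite EU_eq.
  by apply/forallP => i; apply/forallP => j; apply/eqP.
Qed.
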